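(* Let $N$ be a positive integer, $L_1\ge\cdots\ge L_K$ nonnegative integers with $L_1\le N$, and $M=\sum_i L_i$ with $M\ge N$. Then $c((N^{L_1}),\ldots,(N^{L_K});(M^N))=c(((M-N)^{L_1}),\ldots,((M-N)^{L_K});(M^{M-N}))$.
   Context: Littlewood–Richardson coefficients are defined by $\prod_i s_{\lambda^i}=\sum_\mu c(\lambda^1,\ldots,\lambda^K;\mu)s_\mu$ for Schur polynomials $s_\lambda$; $(a^b)$ denotes the rectangular partition with $b$ parts equal to $a$ (empty if $a=0$ or $b=0$). *)

(* Defs.v *)
From HB Require Import structures.
From mathcomp Require Import all_boot all_order all_algebra.
From mathcomp Require Import mpoly.
Set Implicit Arguments. Unset Strict Implicit. Unset Printing Implicit Defensive.
Import Order.TTheory GRing.Theory Num.Theory.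
Local Open Scope ring_scope.

(* A partition is represented as a weakly decreasing seq nat of positive parts. *)

Definition rect (a b : nat) : seq nat := if a == 0%N then [::] else nseq b a.

Definition cell (la : seq nat) :=
  {p : 'I_(size la) * 'I_(head 0%N la) | (p.2 < nth 0 la p.1)%N}.

Definition is_ssyt (la : seq nat) (n : nat) (T : {ffun cell la -> 'I_n}) : bool :=
  [forall a : cell la, forall b : cell la,
     (((val a).1 == (val b).1) && ((val a).2 < (val b).2)%N ==> (T a <= T b)%N) &&
     (((val a).2 == (val b).2) && ((val a).1 < (val b).1)%N ==> (T a < T b)%N)].

Definition schur (n : nat) (la : seq nat) : {mpoly int[n]} :=
  \sum_(T : {ffun cell la -> 'I_n} | is_ssyt T) \prod_(a : cell la) 'X_(T a).

(* Partition encoded by a weakly decreasing vector of n nonnegative parts. *)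
Definition part_of (n d : nat) (f : {ffun 'I_n -> 'I_d}) : seq nat :=
  [seq x <- [seq val (f i) | i <- enum 'I_n] | (0 < x)%N].

Definition nonincr (n d : nat) (f : {ffun 'I_n -> 'I_d}) : bool :=
  [forall i : 'I_n, forall j : 'I_n, (i <= j)%N ==> (f j <= f i)%N].

(* c is a family of Littlewood-Richardson coefficients for the product of the
   Schur polynomials s_{la} (la in ls), computed in n variables:
   prod_{la in ls} s_la = sum_{mu, l(mu) <= n} c(mu) s_mu,
   where mu ranges over all partitions with at most n parts, each part at most
   d = total size of the factors (which contains all partitions of size d). *)
Definition is_LR_expansion (n : nat) (ls : seq (seq nat)) (c : seq nat -> int) : Prop :=
  let d := sumn (map sumn ls) in
  \prod_(la <- ls) schur n la =
  \sum_(f : {ffun 'I_n -> 'I_d.+1} | nonincr f) (c (part_of f))%:~R * schur n (part_of f).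

(* Main.v *)
Require Import Defs.
From HB Require Import structures.
From mathcomp Require Import all_boot all_order all_algebra all_fingroup.
From mathcomp Require Import mpoly zify.

(**
By Jacobi-Trudi, the product of the Schur polynomials of the rectangles
(b^l), l in L, is the determinant of a block-diagonal matrix of size M = sum L
with entries h_{b+q-p}. Expanding it and using h_{r_1} ... h_{r_M} =
sum_mu K_{mu,r} s_mu, the coefficient of s_{(M^b)} is the signed sum of the
Kostka numbers K_{(M^b), r(w)}, with r(w)_p = b + w(p) - p, over the
permutations w preserving the blocks. Complementing each row of a
Gelfand-Tsetlin pattern gives K_{(M^b), r} = K_{(M^(M-b)), M - r}; and M - r(w)
is a rearrangement of the exponents attached to w^-1 and the rectangles of
width M - b, so symmetry of Kostka numbers in r matches the two sums.

Everything is computed after multiplication by alternants a_alpha =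
det(x_j^alpha_i): Pieri's rule for a_{g+delta} h_t says that h-products times
a_delta are counted by chains of horizontal strips, that is, by tableaux.
Comparing coefficients with a_alpha = det(h_{alpha_i - delta_k}) a_delta gives
a_delta s_f = a_{f+delta}, whence linear independence of Schur polynomials.
*)

Set Implicit Arguments. Unset Strict Implicit. Unset Printing Implicit Defensive.
Import Order.TTheory GRing.Theory.
Local Open Scope ring_scope.

(** * Polynomials modulo a power of the variable, standing in for power series *)

Section CongruencePolynomials.
Variables (R : comNzRingType) (D : nat).
Implicit Types p q : {poly R}.

Definition coef_eq_below p q := forall i, (i < D)%N -> p`_i = q`_i.

Lemma coef_eq_below_mul p p' q q' :
  coef_eq_below p p' -> coef_eq_below q q' -> coef_eq_below (p * q) (p' * q').
Proof.
move=> hp hq i hi; rewrite !coefM; apply: eq_bigr => j _.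
by rewrite hp ?hq //; have := ltn_ord j; lia.
Qed.

Lemma coef_eq_below_prod (I : finType) (P : pred I) (F G : I -> {poly R}) :
  (forall i, P i -> coef_eq_below (F i) (G i)) ->
  coef_eq_below (\prod_(i | P i) F i) (\prod_(i | P i) G i).
Proof.
by move=> h; apply: (big_ind2 coef_eq_below) => // *; apply: coef_eq_below_mul.
Qed.

Lemma coef_eq_below_det n (A B : 'M[{poly R}]_n) :
  (forall i j, coef_eq_below (A i j) (B i j)) ->
  coef_eq_below (\det A) (\det B).
Proof.
move=> h i hi; rewrite /determinant !coef_sum; apply: eq_bigr => s _.
by apply: coef_eq_below_mul hi => //; apply: coef_eq_below_prod => k _.
Qed.

End CongruencePolynomials.

Lemma sum_ord_support (V : nmodType) a b (F : nat -> V) :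
  (forall k, (a <= k)%N -> F k = 0) -> (forall k, (b <= k)%N -> F k = 0) ->
  \sum_(k < a) F k = \sum_(k < b) F k.
Proof.
wlog hab : a b / (a <= b)%N => [hw ha hb|ha _].
  by case/orP: (leq_total a b) => h; [apply: hw|symmetry; apply: hw].
rewrite (big_ord_widen _ _ hab) big_mkcond /=; apply: eq_bigr => k _.
by case: ltnP => // /ha.
Qed.

(** Multilinearity of the determinant in its rows: a family [f] picks one summand from each row. *)
Lemma det_row_sum (R : comNzRingType) n (J : finType) (Q : 'I_n -> pred J)
    (F : 'I_n -> J -> 'I_n -> R) :
  \det (\matrix_(i, j) \sum_(e | Q i e) F i e j) =
  \sum_(f in family Q) \det (\matrix_(i, j) F i (f i) j).
Proof.
rewrite /determinant exchange_big /=; apply: eq_bigr => s _.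
rewrite -big_distrr /=; congr (_ * _).
under eq_bigr do rewrite mxE.
rewrite bigA_distr_big_dep; apply: eq_bigr => f _.
by under [RHS]eq_bigr do rewrite mxE.
Qed.

(** * Alternants and their coefficients *)

Section Alternants.
Variable n : nat.
Local Notation R := {mpoly int[n]}.
Implicit Types a : 'I_n -> nat.

(** The staircase (n-1, ..., 1, 0), whose alternant is the Vandermonde determinant. *)
Definition delta (i : 'I_n) : nat := (n - i.+1)%N.

Definition alternant a : R := \det (\matrix_(i, j) 'X_j ^+ a i).

Definition shifted (f : 'I_n -> nat) (i : 'I_n) : nat := (f i + delta i)%N.

Lemma eq_alternant a b : a =1 b -> alternant a = alternant b.
Proof. by move=> h; congr (\det _); apply/matrixP=> i j; rewrite !mxE h. Qed.

Lemma alternantE a :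
  alternant a = \sum_(s : 'S_n) (-1) ^+ s * 'X_[[multinom a ((s^-1)%g i) | i < n]].
Proof.
apply: eq_bigr => s _; congr (_ * _).
under eq_bigr do rewrite mxE.
rewrite mpolyXE_id [RHS](reindex_inj (@perm_inj _ s)) /=.
by apply: eq_bigr => i _; rewrite mnmE permK.
Qed.

Lemma mcoeff_signM (b : bool) (p : R) m : ((-1) ^+ b * p)@_m = (-1) ^+ b * p@_m.
Proof. by case: b; rewrite ?expr1 ?expr0 ?mulN1r ?mul1r ?mcoeffN. Qed.

Lemma mcoeff_alternant a m :
  (alternant a)@_m = \sum_(s : 'S_n) (-1) ^+ s * ([forall i, m (s i) == a i])%:R.
Proof.
rewrite alternantE raddf_sum; apply: eq_bigr => s _ /=.
rewrite mcoeff_signM mcoeffX; congr (_ * (_)%:R); congr nat_of_bool.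
apply/eqP/forallP => [<- i|h]; first by rewrite mnmE permK.
by apply/mnmP => i; rewrite mnmE -(eqP (h _)) permKV.
Qed.

(** Both sides are signed counts of permutations carrying one exponent vector to the other, and
    inversion preserves signs. This later exchanges the monomial being read with the exponents of
    the alternant. *)
Lemma mcoeff_alternant_sym a b :
  (alternant a)@_[multinom b i | i < n] = (alternant b)@_[multinom a i | i < n].
Proof.
rewrite !mcoeff_alternant (reindex_inj invg_inj) /=; apply: eq_bigr => s _.
rewrite odd_permV; congr (_ * (_)%:R); congr nat_of_bool.
apply/forallP/forallP => h i; rewrite mnmE.
  by have := h (s i); rewrite mnmE permK eq_sym.
by have := h ((s^-1)%g i); rewrite mnmE permKV eq_sym.
Qed.

Lemma increasing_perm_ge (s : 'S_n) :
  (forall i j : 'I_n, (i < j)%N -> (s i < s j)%N) -> forall i : 'I_n, (i <= s i)%N.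
Proof.
move=> h [i hi]; elim: i hi => [//|i IH] hi.
by apply: leq_ltn_trans (IH (ltnW hi)) (h _ _ _) => /=.
Qed.

(** The inverse is increasing as well, so both s and its inverse dominate the identity. *)
Lemma increasing_perm_id (s : 'S_n) :
  (forall i j : 'I_n, (i < j)%N -> (s i < s j)%N) -> s = 1%g.
Proof.
move=> h; apply/permP => i; rewrite perm1; apply/val_inj/eqP; rewrite eqn_leq.
rewrite increasing_perm_ge // andbT.
have h' : forall i j : 'I_n, (i < j)%N -> ((s^-1)%g i < (s^-1)%g j)%N.
  move=> {}i j hij; rewrite ltnNge; apply/negP; rewrite leq_eqVlt => /orP[].
    by move/eqP/val_inj/perm_inj => e; rewrite e ltnn in hij.
  by move/h; rewrite !permKV; lia.
by rewrite -{2}(permK s i) increasing_perm_ge.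
Qed.

(** A permutation matching two strictly decreasing sequences is increasing, hence trivial. This is
    the source of the linear independence of the alternants. *)
Lemma mcoeff_alternant_strict a b :
  (forall i j : 'I_n, (i < j)%N -> (a j < a i)%N) ->
  (forall i j : 'I_n, (i < j)%N -> (b j < b i)%N) ->
  (alternant a)@_[multinom b i | i < n] = ([forall i, a i == b i])%:R.
Proof.
move=> ha hb; rewrite mcoeff_alternant (bigD1 1%g) //= odd_perm1 mul1r.
rewrite big1 ?addr0 => [|s /negP hs].
  by congr (_)%:R; congr nat_of_bool; apply: eq_forallb => i; rewrite mnmE perm1 eq_sym.
case: forallP => [h|_]; last by rewrite mulr0.
case: hs; apply/eqP/increasing_perm_id => i j hij.
have := h i; have := h j; rewrite !mnmE => /eqP ej /eqP ei.
have := ha _ _ hij; rewrite -ei -ej; case: (ltngtP (s i) (s j)) => // [|/val_inj/perm_inj] e.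
  by have := hb _ _ e; lia.
by move: hij; rewrite e ltnn.
Qed.

Lemma shifted_strict f : (forall i j : 'I_n, (i <= j)%N -> (f j <= f i)%N) ->
  forall i j : 'I_n, (i < j)%N -> (shifted f j < shifted f i)%N.
Proof.
move=> h i j hij; have := h _ _ (ltnW hij); rewrite /shifted /delta.
by have := ltn_ord j; lia.
Qed.

Lemma alternant_delta_neq0 : alternant delta != 0.
Proof.
apply/eqP => /(congr1 (mcoeff [multinom delta i | i < n])).
have hd (i j : 'I_n) : (i < j)%N -> (delta j < delta i)%N.
  by rewrite /delta; have := ltn_ord j; lia.
rewrite mcoeff_alternant_strict // mcoeff0.
by case: forallP => // [] []; move.
Qed.

End Alternants.

(** * Complete symmetric polynomials and the factorization of alternants *)

Section CompleteSymmetric.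
Variables n D : nat.
Local Notation R := {mpoly int[n]}.

(** The series 1/(1 - x_j X), truncated below degree [D]. *)
Definition geom (j : 'I_n) : {poly R} := \poly_(k < D) 'X_j ^+ k.

(* The complete homogeneous polynomial h_t, for t < D only. *)
Definition hsym (t : nat) : R := (\prod_j geom j)`_t.

(* h_{a - b} for integers, i.e. zero when a < b. *)
Definition hsymB (a b : nat) : R := if (b <= a)%N then hsym (a - b) else 0.

Lemma geom_inv j : coef_eq_below D (geom j * (1 - 'X_j *: 'X)) 1.
Proof.
move=> i hi; rewrite mulrBr mulr1 -scalerAr coefB coefZ coefMX !coef_poly hi coef1.
case: i hi => [|i] hi /=; first by rewrite mulr0 subr0 expr0.
by rewrite (ltnW hi) exprS subrr.
Qed.

(** The generating polynomial of the signed elementary symmetric polynomials in all variables except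
    x_j. *)
Definition omit_gen (j : 'I_n) : {poly R} := \prod_(i | i != j) (1 - 'X_i *: 'X).

Lemma size_omit_gen j : (size (omit_gen j) <= n)%N.
Proof.
apply: (leq_trans (size_poly_prod_leq _ _)).
have hs : (\sum_(i < n | i != j) size (1 - 'X_i *: 'X : {poly R})%R
     <= 2 * #|[pred i : 'I_n | i != j]|)%N; last first.
  rewrite [X in (_ - X)%N](_ : _ = n.-1); last by rewrite cardC1 card_ord.
  move: hs; rewrite cardC1 card_ord; have := ltn_ord j.
  by set s := (\sum_(_ < _ | _) _)%N; lia.
rewrite mulnC -sum_nat_const; apply: leq_sum => i _.
apply: (leq_trans (size_polyD _ _)); rewrite size_poly1 geq_max /= size_polyN.
by apply: (leq_trans (size_scale_leq _ _)); rewrite size_polyX.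
Qed.

Lemma hsym0 : (0 < D)%N -> hsym 0 = 1.
Proof.
move=> hD; rewrite /hsym.
have : coef_eq_below 1 (\prod_j geom j) (\prod_(j < n) 1).
  by apply: coef_eq_below_prod => j _ [|//] _; rewrite coef_poly hD coef1.
by move/(_ 0 isT) ->; rewrite big1_eq coef1.
Qed.

(** Multiplying all the geometric series by [omit_gen j] leaves 1/(1 - x_j X), whose coefficient at
    degree a is x_j^a. As [omit_gen j] has degree below n, its relevant degrees are exactly the
    values of [delta]. *)
Lemma power_omit_gen j a : (a < D)%N ->
  'X_j ^+ a = \sum_(k < n) hsymB a (delta k) * (omit_gen j)`_(delta k) :> R.
Proof.
move=> ha.
have e : 'X_j ^+ a = (\prod_j geom j * omit_gen j)`_a :> R.
  rewrite (bigD1 j) //= -mulrA -big_split /=.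
  have /(_ a ha) -> := @coef_eq_below_mul _ D (geom j) (geom j)
    (\prod_(i | i != j) (geom i * (1 - 'X_i *: 'X))) (\prod_(i < n | i != j) 1)
    (fun _ _ => erefl) (coef_eq_below_prod (fun i _ => @geom_inv i)).
  by rewrite big1_eq mulr1 coef_poly ha.
rewrite {}e coefMr.
pose F k := hsymB a k * (omit_gen j)`_k.
transitivity (\sum_(k < n) F k); last first.
  rewrite (reindex_inj rev_ord_inj) /=.
  by apply: eq_bigr => i _; rewrite /delta.
transitivity (\sum_(k < a.+1) F k).
  by apply: eq_bigr => i _; rewrite /F /hsymB -ltnS ltn_ord.
apply: sum_ord_support => k hk; rewrite /F /hsymB; first by rewrite leqNgt hk mul0r.
by rewrite nth_default ?mulr0 // (leq_trans (size_omit_gen j)).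
Qed.

(* Jacobi-Trudi for arbitrary exponents: the matrix of powers factors through
   the matrix of complete symmetric polynomials, the other factor being
   independent of a. *)
Lemma alternant_hsym (a : 'I_n -> nat) : (n <= D)%N -> (forall i, (a i < D)%N) ->
  alternant a = \det (\matrix_(i, k) hsymB (a i) (delta k)) * alternant (@delta n).
Proof.
move=> hn; pose E : 'M[R]_n := \matrix_(k, j) (omit_gen j)`_(delta k).
have key (b : 'I_n -> nat) : (forall i, (b i < D)%N) ->
    alternant b = \det (\matrix_(i, k) hsymB (b i) (delta k)) * \det E.
  move=> hb; rewrite -det_mulmx; congr (\det _); apply/matrixP => i j.
  by rewrite !mxE power_omit_gen //; apply: eq_bigr => k _; rewrite !mxE.
move=> ha; rewrite (key a) // (key (@delta n)); last first.
  by move=> i; rewrite /delta; have := ltn_ord i; lia.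
(* For the exponents [delta] the matrix of complete symmetric polynomials is triangular with unit
   diagonal, so det E is the Vandermonde alternant. *)
congr (_ * _); rewrite -[LHS]mul1r; congr (_ * _).
rewrite -det_tr det_trig; last first.
  apply/is_trig_mxP => i k hik; rewrite !mxE /hsymB ifF // /delta.
  by have := ltn_ord i; have := ltn_ord k; lia.
rewrite big1 // => i _; rewrite !mxE /hsymB leqnn subnn hsym0 //.
exact: leq_trans (leq_ltn_trans _ (ltn_ord i)) hn.
Qed.

End CompleteSymmetric.

(** * Pieri's rule for alternants *)

Section Pieri.
Variables n d : nat.
Local Notation R := {mpoly int[n]}.
Local Notation vec := {ffun 'I_n -> 'I_d.+1}.
Implicit Types f g : vec.

Definition parts f (i : 'I_n) : nat := f i.

Definition weight f : nat := \sum_i parts f i.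

(** The interlacing form f_0 >= g_0 >= f_1 >= g_1 >= ... of a horizontal strip f/g. *)
Definition hstrip (g f : 'I_n -> nat) : bool :=
  [forall i, (g i <= f i)%N && [forall k : 'I_n, (k < i)%N ==> (f i <= g k)%N]].

Lemma hstripP (g f : 'I_n -> nat) :
  reflect ((forall i, (g i <= f i)%N) /\ (forall k i : 'I_n, (k < i)%N -> (f i <= g k)%N))
          (hstrip g f).
Proof.
apply: (iffP forallP) => [h|[h1 h2] i].
  split=> [i|k i hki]; first by case/andP: (h i).
  by case/andP: (h i) => _ /forallP/(_ k)/implyP; apply.
by rewrite h1; apply/forallP => k; apply/implyP => /h2.
Qed.

Lemma nonincrP f :
  reflect (forall i j : 'I_n, (i <= j)%N -> (parts f j <= parts f i)%N) (nonincr f).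
Proof.
apply: (iffP forallP) => [h i j|h i]; first by have /forallP/(_ j)/implyP := h i.
by apply/forallP => j; apply/implyP/h.
Qed.

Lemma hstrip_nonincr (g : 'I_n -> nat) f : hstrip g (parts f) -> nonincr f.
Proof.
case/hstripP => h1 h2; apply/nonincrP => i j.
rewrite leq_eqVlt => /orP[/eqP/val_inj -> //|hij].
exact: leq_trans (h2 _ _ hij) (h1 _).
Qed.

(** Row i lets the part g_i grow without restriction, X recording the new part. Up to degree d,
    entry (i, j) is a monomial times the geometric series of x_j, which makes the determinant
    computable. *)
Let tail_rows g : 'M[{poly R}]_n :=
  \matrix_(i, j) \poly_(e < d.+1) (if (g i <= e)%N then 'X_j ^+ (e + delta i) else 0).

(** Here the growth of each part is limited as in a horizontal strip, so that expanding the
    determinant by rows yields the right-hand side of Pieri's rule. *)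
Let strip_rows g : 'M[{poly R}]_n :=
  \matrix_(i, j) \sum_(e : 'I_d.+1 | (g i <= e)%N &&
     [forall k : 'I_n, (k < i)%N ==> (e <= g k)%N]) 'X_j ^+ (e + delta i) *: 'X^e.

(* Subtracting t times the previous row cuts each row of tails down to the range
   allowed by a horizontal strip. *)
Let elim_mx : 'M[{poly R}]_n := \matrix_(i, k) ((i == k)%:R - (k.+1 == i)%:R *: 'X).

Let det_elim : \det elim_mx = 1.
Proof.
rewrite det_trig.
  rewrite big1 // => i _; rewrite !mxE eqxx (_ : (_ == _ :> nat) = false) ?scale0r ?subr0 //.
  by apply/eqP; lia.
apply/is_trig_mxP => i k hik; rewrite !mxE -val_eqE /=.
rewrite (_ : (i == k :> nat) = false) 1?(_ : (k.+1 == i) = false).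
- by rewrite scale0r subr0.
- by apply/eqP; lia.
by apply/eqP; lia.
Qed.

Let strip_rows_elim g i j : nonincr g ->
  coef_eq_below d.+1 (strip_rows g i j) ((elim_mx *m tail_rows g) i j).
Proof.
move=> /nonincrP hg e he; rewrite !mxE coef_sum.
under eq_bigr do rewrite coefZ coefXn.
rewrite (bigD1 i) //= !mxE eqxx (_ : (i.+1 == i) = false); last by apply/eqP; lia.
rewrite scale0r subr0 mul1r coefD coef_poly he.
have hL : \sum_(k : 'I_d.+1 | (g i <= k)%N &&
      [forall l : 'I_n, (l < i)%N ==> (k <= g l)%N])
    'X_j ^+ (k + delta i) * (e == k)%:R = (if (g i <= e)%N &&
      [forall l : 'I_n, (l < i)%N ==> (e <= g l)%N] then 'X_j ^+ (e + delta i) else 0) :> R.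
  rewrite big_mkcond (bigD1 (Ordinal he)) //= eqxx mulr1 big1 ?addr0 //.
  move=> k /negP hk; case: ifP => // _; case: eqP => [e1|_]; last by rewrite mulr0.
  by case: hk; apply/eqP/val_inj.
rewrite {}hL; case: (posnP i) => hi0.
  rewrite big1 ?coef0 ?addr0; last first.
    move=> k hk; rewrite !mxE eq_sym (negbTE hk) hi0 scale0r subr0 mul0r //.
  by rewrite (_ : [forall l, _]) ?andbT //; apply/forallP => l; rewrite hi0.
have hp : (i.-1 < n)%N by have := ltn_ord i; lia.
rewrite (bigD1 (Ordinal hp)) /=; last by rewrite -val_eqE /=; apply/eqP; lia.
rewrite big1 ?addr0; last first.
  move=> k /andP[hk1 hk2]; rewrite !mxE eq_sym (negbTE hk1) (_ : (_ == _ :> nat) = false).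
    by rewrite scale0r subr0 mul0r.
  by apply/eqP => ek; case/negP: hk2; apply/eqP/val_inj => /=; lia.
rewrite !mxE -val_eqE /= prednK // eqxx (_ : (_ == _ :> nat) = false); last by apply/eqP; lia.
rewrite scale1r sub0r mulNr coefN mulrC coefMX coef_poly.
have -> : [forall l : 'I_n, (l < i)%N ==> (e <= g l)%N] = (e <= g (Ordinal hp))%N.
  apply/forallP/idP => [/(_ (Ordinal hp))/implyP|h l]; first by apply => /=; lia.
  by apply/implyP => hl; apply: (leq_trans h); apply: hg => /=; lia.
have hgi : (parts g i <= parts g (Ordinal hp))%N by apply: hg => /=; lia.
rewrite /parts in hgi.
case: e he => [|e] he /=; first by rewrite leq0n andbT subr0.
(* [delta] drops by one from row to row, so X times the previous row carries the same powers of x_j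
   and the common tails cancel. *)
rewrite (ltnW he); have -> : (e + delta (Ordinal hp) = e.+1 + delta i)%N.
  by rewrite /delta /=; have := ltn_ord i; lia.
case: (leqP (g (Ordinal hp)) e) => h1.
  by rewrite andbF ifT ?subrr //; lia.
by rewrite andbT subr0.
Qed.

Let tail_rows_geom g i j :
  coef_eq_below d.+1 (tail_rows g i j)
    (('X_j ^+ (shifted (parts g) i) *: 'X^(g i)) * geom d.+1 j).
Proof.
move=> e he; rewrite !mxE coef_poly he -scalerAl coefZ mulrC coefXnM coef_poly.
case: (leqP (g i) e) => h; last by rewrite mul0r.
rewrite ifT; last by lia.
by rewrite -exprD /shifted /parts; congr (_ ^+ _); lia.
Qed.

Let det_monomial (u : 'I_n -> nat) :
  \det (\matrix_(i, j) ('X_j ^+ (shifted u i) *: 'X^(u i) : {poly R})) =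
  alternant (shifted u) *: 'X^(\sum_i u i).
Proof.
have -> : (\matrix_(i, j) ('X_j ^+ shifted u i *: 'X^(u i) : {poly R})) =
    diag_mx (\row_i 'X^(u i)) *m map_mx polyC (\matrix_(i, j) 'X_j ^+ shifted u i).
  by apply/matrixP => i j; rewrite mul_diag_mx !mxE mulrC mul_polyC.
rewrite det_mulmx det_diag det_map_mx mulrC mul_polyC; congr (_ *: _).
by under eq_bigr do rewrite mxE; rewrite prodrXr.
Qed.

(** The coefficient of X^(|g| + t) in det [strip_rows] is computed twice: by row elimination it is
    the left-hand side, by multilinearity the right-hand side. The bound d keeps this degree below
    the truncation. *)
Lemma pieri g t : nonincr g -> (weight g + t <= d)%N ->
  alternant (shifted (parts g)) * hsym n d.+1 t =
  \sum_(f : vec | hstrip (parts g) (parts f) && (weight f == weight g + t)%N)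
     alternant (shifted (parts f)).
Proof.
move=> hg ht.
have <- : (\det (strip_rows g))`_(weight g + t) =
    alternant (shifted (parts g)) * hsym n d.+1 t.
  rewrite (coef_eq_below_det (D := d.+1) (B := elim_mx *m tail_rows g)); last 2 first.
  - by move=> i j; apply: strip_rows_elim.
  - by rewrite ltnS.
  rewrite det_mulmx det_elim mul1r.
  rewrite (coef_eq_below_det (D := d.+1)
     (B := (\matrix_(i, j) ('X_j ^+ shifted (parts g) i *: 'X^(parts g i))) *m
           diag_mx (\row_j geom d.+1 j))); last 2 first.
  - by move=> i j; have := @tail_rows_geom g i j; rewrite mul_mx_diag !mxE.
  - by rewrite ltnS.
  rewrite det_mulmx det_diag det_monomial -scalerAl coefZ; congr (_ * _).
  rewrite (eq_bigr (geom d.+1)) => [|j _]; last by rewrite mxE.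
  by rewrite mulrC coefMXn ltnNge leq_addr /= addKn.
rewrite det_row_sum coef_sum [RHS]big_mkcondr /=.
apply: eq_big => [f|f _].
  by rewrite /hstrip; apply/familyP/forallP.
by rewrite det_monomial coefZ coefXn eq_sym; case: eqP; rewrite ?mulr1 ?mulr0.
Qed.

End Pieri.

(** * Kostka numbers and products of complete symmetric polynomials *)

Section Kostka.
Variables n d : nat.
Local Notation R := {mpoly int[n]}.
Local Notation vec := {ffun 'I_n -> 'I_d.+1}.
Implicit Types (f g : vec) (r : nat -> nat).

(** Counts chains of k horizontal strips, of sizes r 0, ..., r (k-1), from the empty shape to f;
    these are Gelfand-Tsetlin patterns. The content r is not assumed monotone. *)
Fixpoint kostka k f r : nat :=
  if k is k'.+1 then
    \sum_(g : vec | hstrip (parts g) (parts f) && (weight f == weight g + r k')%N)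
       kostka k' g r
  else weight f == 0%N.

(** A horizontal strip adds at most one new row, so k strips reach at most k rows. *)
Lemma kostka_neq0 k f r : kostka k f r != 0%N ->
  [/\ nonincr f, weight f = \sum_(i < k) r i
    & forall i : 'I_n, (k <= i)%N -> parts f i = 0%N].
Proof.
elim: k f => [|k IH] f /=.
  rewrite eqb0 negbK sum_nat_eq0 => /forallP h.
  have h0 i : parts f i = 0%N by apply/eqP; have := h i.
  by split=> //; [apply/nonincrP => i j _; rewrite h0|rewrite big_ord0 /weight big1].
rewrite sum_nat_eq0 negb_forall => /existsP[g].
rewrite negb_imply => /andP[/andP[hgf /eqP ->] /IH[hg -> hl]].
split; [exact: hstrip_nonincr hgf | by rewrite big_ord_recr |].
case/hstripP: hgf => h1 h2 i hi.
have hp : (i.-1 < n)%N by have := ltn_ord i; lia.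
have : (parts f i <= parts g (Ordinal hp))%N by apply: h2 => /=; lia.
by rewrite hl ?leqn0 => [/eqP//|/=]; lia.
Qed.

(** Pieri's rule iterated from the empty shape, whose alternant is that of [delta]. *)
Lemma kostka_prod k r : (\sum_(i < k) r i <= d)%N ->
  \prod_(i < k) hsym n d.+1 (r i) * alternant (@delta n) =
  \sum_(f : vec) (kostka k f r)%:R * alternant (shifted (parts f)).
Proof.
elim: k => [|k IH] hr.
  rewrite big_ord0 mul1r /= (bigD1 [ffun=> ord0]) //=.
  rewrite (_ : weight _ = 0%N) ?eqxx ?mul1r; last first.
    by rewrite /weight big1 // => i _; rewrite /parts ffunE.
  rewrite big1 ?addr0; last first.
    move=> f hf; case: eqP => [/eqP|_]; last by rewrite mul0r.
    rewrite sum_nat_eq0 => /forallP h; case/eqP: hf; apply/ffunP => i.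
    by apply/val_inj/eqP; rewrite ffunE; have := h i.
  by apply: eq_alternant => i; rewrite /shifted /parts ffunE.
rewrite big_ord_recr /= in hr; rewrite big_ord_recr /= mulrAC.
rewrite IH ?(leq_trans _ hr) ?leq_addr //.
rewrite mulr_suml.
under [RHS]eq_bigr => f _ do rewrite natr_sum mulr_suml.
rewrite [RHS](exchange_big_dep xpredT) //=; apply: eq_bigr => g _.
have [->|/kostka_neq0[hg hw _]] := eqVneq (kostka k g r) 0%N.
  by rewrite !mul0r big1 // => f _; rewrite mul0r.
by rewrite -mulrA pieri // ?hw // mulr_sumr.
Qed.

Lemma mcoeff_intM (z : int) (p : R) m : (z%:~R * p)@_m = z * p@_m.
Proof. by rewrite mulrzl raddfMz -mulrzl intz. Qed.

(** The monomial with exponents f + delta occurs in just one of these alternants, so it reads off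
    the coefficient at f. *)
Lemma mcoeff_alternant_sum (c : vec -> int) f : nonincr f ->
  (\sum_(g : vec | nonincr g) (c g)%:~R * alternant (shifted (parts g)))
    @_[multinom shifted (parts f) i | i < n] = c f.
Proof.
move=> hf; rewrite raddf_sum (bigD1 f) //= mcoeff_intM.
rewrite mcoeff_alternant_strict; try by apply/shifted_strict/nonincrP.
rewrite (_ : [forall i, _]) ?mulr1; last by apply/forallP.
rewrite big1 ?addr0 // => g /andP[hg hgf]; rewrite mcoeff_intM.
rewrite mcoeff_alternant_strict; try by apply/shifted_strict/nonincrP.
case: forallP => [h|_]; last by rewrite mulr0.
case/eqP: hgf; apply/ffunP => i; apply/val_inj/eqP.
by have := h i; rewrite /shifted eqn_add2r.
Qed.

Lemma kostka_prod_nonincr k r : (\sum_(i < k) r i <= d)%N ->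
  \prod_(i < k) hsym n d.+1 (r i) * alternant (@delta n) =
  \sum_(f : vec | nonincr f) (kostka k f r)%:~R * alternant (shifted (parts f)).
Proof.
move=> hr; rewrite kostka_prod // [RHS]big_mkcond /=; apply: eq_bigr => f _.
case: ifP => // hf; have [->|/kostka_neq0[]] := eqVneq (kostka k f r) 0%N.
  by rewrite mul0r.
by rewrite hf.
Qed.

Lemma kostka_mcoeff k f r : nonincr f -> (\sum_(i < k) r i <= d)%N ->
  (\prod_(i < k) hsym n d.+1 (r i) * alternant (@delta n))
    @_[multinom shifted (parts f) i | i < n] = kostka k f r.
Proof. by move=> hf hr; rewrite kostka_prod_nonincr // mcoeff_alternant_sum. Qed.

(** Kostka numbers are coefficients of a product of complete symmetric polynomials, and that product
    is commutative. *)
Lemma kostka_perm k (s : 'S_k) f r r' : nonincr f -> (\sum_(i < k) r i <= d)%N ->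
  (forall i : 'I_k, r' i = r (s i)) -> kostka k f r' = kostka k f r.
Proof.
move=> hf hr hs; apply/eqP; rewrite -eqz_nat -!kostka_mcoeff //.
  apply/eqP; congr (_@_ _); congr (_ * _).
  by rewrite [RHS](reindex_inj (@perm_inj _ s)); apply: eq_bigr => i _; rewrite hs.
rewrite (eq_bigr (fun i => r (s i))) //; apply: leq_trans hr.
by rewrite [leqRHS](reindex_inj (@perm_inj _ s)).
Qed.

(** A horizontal strip has at most one cell in each of the at most b columns. *)
Lemma kostka_size_le k f r b : (forall i, (parts f i <= b)%N) ->
  kostka k f r != 0%N -> forall i, (i < k)%N -> (r i <= b)%N.
Proof.
elim: k f => [//|k IH] f hb /=.
rewrite sum_nat_eq0 negb_forall => /existsP[g].
rewrite negb_imply => /andP[/andP[/hstripP[h1 h2] /eqP hw] hk] i.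
rewrite ltnS leq_eqVlt => /orP[/eqP ->|hi]; last first.
  by apply: IH hk i hi => j; apply: leq_trans (h1 j) (hb j).
(* By interlacing, the first row of f has at most b cells and each later row fits in the row of g
   above it. *)
suff : (weight f <= b + weight g)%N by lia.
rewrite /weight; clear -h2 hb; case: n f g hb h2 => [|m] f g hb h2.
  by rewrite !big_ord0.
rewrite big_ord_recl [X in (_ <= _ + X)%N]big_ord_recr /=.
have : (\sum_(i < m) parts f (lift ord0 i) <= \sum_(i < m) parts g (widen_ord (leqnSn m) i))%N.
  by apply: leq_sum => j _; apply: h2 => /=; rewrite /bump; lia.
by move=> h; apply: leq_add (hb ord0) (leq_trans h (leq_addr _ _)).
Qed.

End Kostka.

(** * Complements of Gelfand-Tsetlin patterns in a rectangle *)

Section KostkaComplement.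
Variable n : nat.
Local Notation vec d := {ffun 'I_n -> 'I_d.+1}.

(** Extension by zero lets reversed row indices be computed in [nat] without proofs of bounds. *)
Definition extend0 (u : 'I_n -> nat) (m : nat) : nat := oapp u 0%N (insub m).

Lemma extend0E u (i : 'I_n) : extend0 u i = u i.
Proof. by rewrite /extend0 valK. Qed.

Lemma extend0_out u m : (n <= m)%N -> extend0 u m = 0%N.
Proof. by move=> h; rewrite /extend0 insubN // -leqNgt. Qed.

Lemma eq_extend0 u v : u =1 v -> extend0 u =1 extend0 v.
Proof. by move=> h m; rewrite /extend0; case: insub => //= i. Qed.

Lemma extend0_ind (P : nat -> nat -> Prop) u :
  (forall i : 'I_n, P i (u i)) -> (forall m, (n <= m)%N -> P m 0%N) ->
  forall m, P m (extend0 u m).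
Proof.
move=> h1 h2 m; case: (ltnP m n) => hm; last by rewrite extend0_out //; apply: h2.
by have := h1 (Ordinal hm); rewrite -[u _]extend0E.
Qed.

Lemma sum_extend0 u k : (forall m, (k <= m)%N -> extend0 u m = 0%N) ->
  \sum_i u i = \sum_(i < k) extend0 u i.
Proof.
move=> h; rewrite -(@sum_ord_support _ n k (extend0 u)) //; last exact: extend0_out.
by apply: eq_bigr => i _; rewrite extend0E.
Qed.

Lemma hstrip_extend0 g f : hstrip g f <->
  (forall m, (extend0 g m <= extend0 f m)%N) /\
  (forall l m, (l < m)%N -> (extend0 f m <= extend0 g l)%N).
Proof.
split=> [/hstripP[h1 h2]|[h1 h2]].
  split=> [m|l m hlm].
    case: (ltnP m n) => hm; last by rewrite !extend0_out.
    by have := h1 (Ordinal hm); rewrite -[g _]extend0E -[f _]extend0E.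
  case: (ltnP m n) => hm; last by rewrite extend0_out.
  by have := h2 (Ordinal (ltn_trans hlm hm)) (Ordinal hm) hlm;
     rewrite -[g _]extend0E -[f _]extend0E.
apply/hstripP; split=> [i|k i hki]; first by have := h1 i; rewrite !extend0E.
by have := h2 k i hki; rewrite !extend0E.
Qed.

Definition recast d d' (f : vec d) : vec d' := [ffun i => inord (parts f i)].

(** Every shape in a chain is contained in the last one, so both recursions run through the same
    shapes. *)
Lemma kostka_recast d d' k (f : vec d) (f' : vec d') r :
  parts f =1 parts f' -> kostka k f r = kostka k f' r.
Proof.
have recastE e e' (g : vec e) (h : vec e') : (forall i, (parts g i <= parts h i)%N) ->
    parts (recast e' g) =1 parts g.
  by move=> hgh i; rewrite /parts ffunE inordK //; apply: leq_ltn_trans (hgh i) (ltn_ord _).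
have weightE e e' (g : vec e) (g' : vec e') : parts g =1 parts g' -> weight g = weight g'.
  by move=> h; apply: eq_bigr => i _; rewrite h.
have hstripE (a b a' b' : 'I_n -> nat) : a =1 a' -> b =1 b' -> hstrip a b = hstrip a' b'.
  move=> ha hb; apply: eq_forallb => i; rewrite ha hb; congr (_ && _).
  by apply: eq_forallb => j; rewrite ha.
have castK e e' (g : vec e) (h : vec e') : (forall i, (parts g i <= parts h i)%N) ->
    recast e (recast e' g) = g.
  move=> hgh; apply/ffunP => i; apply/val_inj.
  by rewrite ffunE /= inordK (recastE _ _ _ h) //; apply: ltn_ord.
elim: k f f' => [|k IH] f f' hf /=; first by rewrite (weightE _ _ _ f').
have le (g : vec d) : hstrip (parts g) (parts f) -> forall i, (parts g i <= parts f' i)%N.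
  by move=> /hstripP[h _] i; rewrite -hf.
have le' (g : vec d') : hstrip (parts g) (parts f') -> forall i, (parts g i <= parts f i)%N.
  by move=> /hstripP[h _] i; rewrite hf.
rewrite (reindex_onto (@recast d' d) (@recast d d')) /=; last first.
  by move=> g /andP[/le hg _]; apply: castK hg.
apply: eq_big => [g|g /andP[/andP[hg _] /eqP e]]; last first.
  by apply: IH => i; have := recastE _ _ _ _ (le _ hg) i; rewrite e.
apply/andP/andP => [[/andP[h1 h2] /eqP h3]|[h1 h2]].
  have e1 := recastE _ _ _ _ (le _ h1); rewrite h3 in e1.
  rewrite (hstripE _ _ _ _ e1 (fsym hf)) h1; split=> //.
  by rewrite -(weightE _ _ _ _ hf) (eqP h2) (weightE _ _ _ _ e1).
have e1 := recastE _ _ _ _ (le' _ h1).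
rewrite (castK _ _ _ _ (le' _ h1)) eqxx (hstripE _ _ _ _ e1 hf) h1; split=> //.
by rewrite (weightE _ _ _ _ hf) (eqP h2) (weightE _ _ _ _ e1) eqxx.
Qed.

Section Complement.
Variable b : nat.

(** The complement of u in the rectangle of k rows and width b, turned by a half turn. *)
Definition flip k (u : 'I_n -> nat) (i : 'I_n) : nat :=
  if (i < k)%N then (b - extend0 u (k.-1 - i))%N else 0%N.

Definition fits k (u : 'I_n -> nat) :=
  (forall i, (u i <= b)%N) /\ (forall i : 'I_n, (k <= i)%N -> u i = 0%N).

Lemma extend0_flip k u m : (k <= n)%N ->
  extend0 (flip k u) m = if (m < k)%N then (b - extend0 u (k.-1 - m))%N else 0%N.
Proof.
move=> hk; case: (ltnP m n) => hm; last by rewrite extend0_out // ltnNge (leq_trans hk).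
by rewrite -[m]/(val (Ordinal hm)) extend0E.
Qed.

Lemma fits_extend0 k u : fits k u <->
  (forall m, (extend0 u m <= b)%N) /\ (forall m, (k <= m)%N -> extend0 u m = 0%N).
Proof.
split=> [[h1 h2]|[h1 h2]].
  split; first by apply: (@extend0_ind (fun _ x => x <= b)%N).
  by apply: (@extend0_ind (fun m x => (k <= m)%N -> x = 0%N)).
by split=> i; [have := h1 i | have := h2 i]; rewrite extend0E.
Qed.

Lemma fits_flip k u : (k <= n)%N -> fits k (flip k u).
Proof.
move=> hk; apply/fits_extend0; split=> m; rewrite extend0_flip //.
  by case: ifP => // _; apply: leq_subr.
by rewrite ltnNge => ->.
Qed.

Lemma flipK k u : (k <= n)%N -> fits k u -> flip k (flip k u) =1 u.
Proof.
move=> hk /fits_extend0[h1 h2] i; rewrite /flip; case: ltnP => hi; last first.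
  by have := h2 i hi; rewrite extend0E.
rewrite extend0_flip // ifT; last by lia.
rewrite (_ : (k.-1 - (k.-1 - i) = i)%N); last by lia.
by rewrite -[u i]extend0E; have := h1 i; lia.
Qed.

Lemma sum_flip k u : (k <= n)%N -> fits k u ->
  (\sum_i flip k u i + \sum_i u i = k * b)%N.
Proof.
move=> hk /fits_extend0[h1 h2].
rewrite (@sum_extend0 u k) // (@sum_extend0 (flip k u) k); last first.
  by move=> m hm; rewrite extend0_flip // ltnNge hm.
rewrite [X in (_ + X)%N](reindex_inj rev_ord_inj) -big_split /=.
rewrite -[RHS]/(muln k b) -[in RHS](card_ord k) -sum_nat_const; apply: eq_bigr => i _.
rewrite extend0_flip // ltn_ord -subn1 -subnDA add1n; have := h1 (k - i.+1)%N; lia.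
Qed.

(** Negating and reversing f_0 >= g_0 >= ... >= g_(k-1) >= f_k gives an interlacing sequence again;
    f therefore needs one row more than g. *)
Lemma hstrip_flip k g f : (k < n)%N -> fits k g -> fits k.+1 f ->
  hstrip g f -> hstrip (flip k g) (flip k.+1 f).
Proof.
move=> hk /fits_extend0[g1 g2] /fits_extend0[f1 f2] /hstrip_extend0[h1 h2].
apply/hstrip_extend0; split=> [m|l m hlm]; rewrite !extend0_flip ?(ltnW hk) //=.
  case: (ltnP m k) => hm //; rewrite ifT; last by lia.
  by have := h2 (k.-1 - m)%N (k - m)%N ltac:(lia); lia.
case: ifP => hm //; rewrite ifT; last by lia.
have := h1 (k.-1 - l)%N; have [e|hl] := eqVneq (k.-1 - l)%N (k - m)%N.
  by rewrite e; lia.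
have := h2 (k - m)%N (k.-1 - l)%N ltac:(lia); have := h1 (k - m)%N; lia.
Qed.

Definition flipv d d' k (g : vec d) : vec d' := [ffun i => inord (flip k (parts g) i)].

Lemma parts_flipv d d' k (g : vec d) : (b <= d')%N ->
  parts (flipv d' k g) =1 flip k (parts g).
Proof.
move=> hb i; rewrite /parts ffunE inordK // ltnS; apply: leq_trans hb.
by rewrite /flip; case: ifP => // _; apply: leq_subr.
Qed.

(** Restricting g to k rows discards only zero terms of the recursion and confines the sum to shapes
    on which [flip k] is an involution, once f fits in the rectangle. *)
Let strip_to d k (f : vec d) t (g : vec d) :=
  [&& hstrip (parts g) (parts f), (weight f == weight g + t)%N
    & [forall i : 'I_n, (k <= i)%N ==> (parts g i == 0%N)]].

Let kostka_strip_to d k (f : vec d) r :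
  kostka k.+1 f r = \sum_(g | strip_to k f (r k) g) kostka k g r.
Proof.
rewrite /= [LHS](eq_bigr (fun g => if [forall i : 'I_n, (k <= i)%N ==> (parts g i == 0%N)]
                            then kostka k g r else 0%N)).
  by rewrite -big_mkcondr; apply: eq_bigl => g; rewrite /strip_to andbA.
move=> g _; case: ifP => // /negbT hg; apply/eqP/negPn/negP => /kostka_neq0[_ _ hl].
by case/negP: hg; apply/forallP => i; apply/implyP => /hl ->.
Qed.

(** The complements have sizes (k+1) b - |f| and k b - |g|, which differ by b - t. *)
Let strip_to_flipv d d' k (f : vec d) (f' : vec d') t (g : vec d) :
  (k < n)%N -> (b <= d')%N -> fits k.+1 (parts f) -> parts f' =1 flip k.+1 (parts f) ->
  (t <= b)%N -> strip_to k f t g ->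
  fits k (parts g) /\ strip_to k f' (b - t) (flipv d' k g).
Proof.
move=> hk hb hf hf' ht /and3P[hgf /eqP hw /forallP hg].
have fg : fits k (parts g).
  split=> [i|i hi]; last by apply/eqP/(implyP (hg i)).
  by case/hstripP: hgf => h _; apply: leq_trans (h i) _; apply: hf.1.
split=> //; apply/and3P; split.
- have := hstrip_flip hk fg hf hgf; rewrite /hstrip => /forallP h.
  apply/forallP => i; rewrite hf' parts_flipv //; have /andP[-> /forallP hi] := h i.
  by apply/forallP => j; rewrite parts_flipv //; apply: hi.
- have := sum_flip (ltnW hk) fg; have := sum_flip hk hf.
  rewrite -!/(weight _) -(eq_bigr _ (fun i _ => hf' i)).
  rewrite -(eq_bigr _ (fun i _ => @parts_flipv d d' k g hb i)) -!/(weight _) hw mulSn.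
  by move=> h1 h2; apply/eqP; lia.
apply/forallP => i; apply/implyP => hi; rewrite parts_flipv //.
by rewrite (fits_flip _ (ltnW hk)).2.
Qed.

(** Complementing the shape at level k in k rows is a bijection between chains, applied one level at
    a time by induction. *)
Lemma kostka_flip d d' k (f : vec d) (f' : vec d') r : (k <= n)%N ->
  (b <= d)%N -> (b <= d')%N -> fits k (parts f) -> parts f' =1 flip k (parts f) ->
  (forall i, (i < k)%N -> (r i <= b)%N) ->
  kostka k f r = kostka k f' (fun i => b - r i)%N.
Proof.
move=> hk hb hb'; elim: k f f' hk => [|k IH] f f' hk hf hf' hr.
  have e1 : weight f = 0%N by rewrite /weight big1 // => i _; apply: hf.2.
  by rewrite /= e1 /weight big1 // => i _; rewrite hf'.
have hr' i : (i < k)%N -> (r i <= b)%N by move=> hi; apply: hr; lia.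
have hrk : (r k <= b)%N by apply: hr.
have ff : parts f =1 flip k.+1 (parts f').
  move=> i; rewrite -(flipK hk hf) /flip; case: ifP => // _.
  by rewrite (eq_extend0 hf').
have flipvK e e' (g : vec e) : (b <= e)%N -> (b <= e')%N -> fits k (parts g) ->
    flipv e k (flipv e' k g) = g.
  move=> he he' hg; apply/ffunP => i; apply/val_inj.
  rewrite -[LHS]/(parts (flipv e k (flipv e' k g)) i) -[RHS]/(parts g i).
  rewrite -[RHS](flipK (ltnW hk) hg) parts_flipv // /flip; case: ifP => // _.
  by rewrite (eq_extend0 (parts_flipv k g he')).
have fit' : fits k.+1 (parts f').
  by split=> [i|i hi]; rewrite hf'; [apply: (fits_flip _ hk).1 | apply: (fits_flip _ hk).2].
rewrite !kostka_strip_to (reindex_onto (flipv d k) (flipv d' k)) /=; last first.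
  move=> g hg; apply: flipvK => //.
  by have [] := strip_to_flipv hk hb' hf hf' hrk hg.
apply: eq_big => [g|g /andP[hg /eqP hgK]].
  apply/andP/idP => [[hg /eqP <-]|hg].
    by have [] := strip_to_flipv hk hb' hf hf' hrk hg.
  have [fg hg'] := strip_to_flipv hk hb fit' ff (leq_subr _ _) hg.
  by rewrite subKn // in hg'; rewrite hg' flipvK.
have [fg _] := strip_to_flipv hk hb' hf hf' hrk hg.
apply: IH => //; first exact: ltnW.
by move=> i; rewrite -{1}hgK parts_flipv.
Qed.

End Complement.
End KostkaComplement.

(** * Semistandard tableaux as chains of horizontal strips *)

Section BoxTableaux.
Local Open Scope nat_scope.

Lemma card_ord_ltn d m : m <= d -> #|[pred j : 'I_d | j < m]| = m.
Proof.
by move=> h; rewrite -sum1_card -(big_ord_widen _ (fun _ => 1) h) sum1_card card_ord.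
Qed.

(** Used to recover the length of a row from the number of its entries below a bound. *)
Lemma card_ord_down d (P : pred 'I_d) :
  (forall i j : 'I_d, i < j -> P j -> P i) -> forall j, P j = (j < #|P|).
Proof.
move=> h j; apply/idP/idP => hj.
  rewrite -[j.+1](card_ord_ltn (ltn_ord j)); apply: subset_leq_card.
  apply/subsetP => i; rewrite !inE ltnS leq_eqVlt => /orP[/eqP/val_inj -> //|hij].
  exact: h hij hj.
apply: contraTT hj => hj; rewrite -leqNgt -[leqRHS](card_ord_ltn (ltnW (ltn_ord j))).
apply: subset_leq_card; apply/subsetP => i hi; rewrite inE ltnNge leq_eqVlt.
apply/negP => /orP[/eqP/val_inj e|hji]; first by case/negP: hj; rewrite e.
by case/negP: hj; apply: h hji hi.
Qed.

Variables n d : nat.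
Local Notation vec := {ffun 'I_n -> 'I_d.+1}.
Local Notation filling := {ffun 'I_n * 'I_d -> 'I_n.+1}.
Implicit Types (f g : vec) (F : filling) (i : 'I_n) (j : 'I_d).

(* A semistandard tableau of shape f with entries below k is encoded as a
   filling of the whole n x d box that takes the value n outside f. *)
Definition box_tableau k f F : bool :=
  [forall c : 'I_n * 'I_d, if c.2 < f c.1 then F c < k else F c == n :> nat] &&
  [forall c : 'I_n * 'I_d, forall c' : 'I_n * 'I_d,
    ((c.1 == c'.1) && (c.2 < c'.2) ==> (F c <= F c')) &&
    ([&& c.2 == c'.2, c.1 < c'.1 & F c' < n] ==> (F c < F c'))].

Lemma box_tableauP k f F : reflect
  [/\ forall i j, j < f i -> F (i, j) < k,
      forall i j, f i <= j -> F (i, j) = n :> nat,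
      forall i (j j' : 'I_d), j < j' -> F (i, j) <= F (i, j') &
      forall (i i' : 'I_n) j, i < i' -> F (i', j) < n -> F (i, j) < F (i', j)]
  (box_tableau k f F).
Proof.
apply: (iffP andP) => [[/forallP h1 /forallP h2]|[h1 h2 h3 h4]].
  split=> [i j h|i j h|i j j' h|i i' j h hn].
  - by have := h1 (i, j); rewrite /= h.
  - by have := h1 (i, j); rewrite /= ltnNge h => /eqP.
  - by have /forallP/(_ (i, j')) := h2 (i, j); rewrite /= eqxx h => /andP[].
  - by have /forallP/(_ (i', j)) := h2 (i, j); rewrite /= eqxx h hn => /andP[].
split; apply/forallP => [[i j]] /=; first by case: ltnP => [/h1//|/h2 ->].
apply/forallP => [[i' j']] /=; apply/andP; split; apply/implyP.
  by case/andP => /eqP <- /h3.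
by case/and3P => /eqP <- hi; apply: h4.
Qed.

Definition content F v := \sum_c (F c == v :> nat).

Definition shape_below k F : vec := [ffun i => inord #|[pred j | F (i, j) < k]|].

Lemma shape_below_card k F i : parts (shape_below k F) i = #|[pred j | F (i, j) < k]|.
Proof.
by rewrite /parts ffunE inordK // ltnS -[leqRHS](card_ord d) max_card.
Qed.

Lemma shape_belowP k l f F i j : box_tableau l f F ->
  (j < parts (shape_below k F) i) = (F (i, j) < k).
Proof.
case/box_tableauP => _ _ h _; rewrite shape_below_card.
rewrite -(card_ord_down (P := [pred j | F (i, j) < k])) //=.
by move=> a b hab /=; apply: leq_ltn_trans (h _ _ _ hab).
Qed.

Lemma weight_cells f : weight f = \sum_(c : 'I_n * 'I_d) (c.2 < f c.1).
Proof.
rewrite -(pair_bigA _ (fun i j => nat_of_bool (j < f i))) /=; apply: eq_bigr => i _.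
rewrite -big_mkcond sum1_card card_ord_ltn //; exact: ltn_ord (f i).
Qed.

Lemma weight_shape_below k f F : k < n -> box_tableau k.+1 f F ->
  weight f = weight (shape_below k F) + content F k.
Proof.
move=> hk hF; rewrite !weight_cells -big_split /=; apply: eq_bigr => [[i j]] _ /=.
rewrite -/(parts _ i) (shape_belowP _ _ _ hF); case/box_tableauP: hF => h1 h2 _ _.
by case: ltnP => [/h1|/h2]; lia.
Qed.

(** Columns increase strictly, so a cell above one with entry at most k has an entry below k. *)
Lemma hstrip_shape_below k f F : k < n -> box_tableau k.+1 f F ->
  hstrip (parts (shape_below k F)) (parts f).
Proof.
move=> hk hF; have hs := shape_belowP k _ _ hF.
case/box_tableauP: hF => h1 h2 h3 h4.
apply/hstripP; split=> [i|i' i hi]; rewrite leqNgt; apply/negP => h.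
  have hd : parts f i < d.
    by apply: leq_trans h _; rewrite -ltnS /parts ltn_ord.
  by move: h; rewrite -[parts f i]/(val (Ordinal hd)) hs h2 //= ; lia.
have hd : parts (shape_below k F) i' < d.
  by apply: leq_trans h _; rewrite -ltnS /parts ltn_ord.
have := h1 i (Ordinal hd) h => h5; have h6 := h4 i' i (Ordinal hd) hi ltac:(lia).
by have := hs i' (Ordinal hd); rewrite ltnn; lia.
Qed.

(** Writes k into the cells of f left free by F; [cut] goes back, replacing k by the outside value
    n. *)
Definition glue f k F : filling :=
  [ffun c => if (F c == n :> nat) && (c.2 < f c.1) then inord k else F c].

Definition cut k F : filling := [ffun c => if F c == k :> nat then ord_max else F c].

Lemma glueE f k F c : k < n ->
  glue f k F c = (if (F c == n :> nat) && (c.2 < f c.1) then k else F c) :> nat.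
Proof. by move=> hk; rewrite ffunE; case: ifP => // _; rewrite inordK // ltnS ltnW. Qed.

Lemma cutE k F c : cut k F c = (if F c == k :> nat then n else F c) :> nat.
Proof. by rewrite ffunE; case: ifP. Qed.

Lemma glue_box_tableau k f g F : k < n -> hstrip (parts g) (parts f) ->
  box_tableau k g F -> box_tableau k.+1 f (glue f k F).
Proof.
move=> hk /hstripP[hs1 hs2] /box_tableauP[h1 h2 h3 h4].
have hlt i j : (F (i, j) < n) = (j < g i).
  by case: (ltnP j (g i)) => [/h1|/h2]; lia.
apply/box_tableauP; split=> [i j h|i j h|i j j' h|i i' j h].
- rewrite glueE //= h andbT; have := ltn_ord (F (i, j)); have := h1 i j.
  by have := hlt i j; case: ifP; lia.
- rewrite glueE //= ltnNge h andbF; apply: h2; exact: leq_trans (hs1 i) h.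
- by rewrite !glueE //=; have := h3 i _ _ h; have := h1 i j; have := h1 i j';
    have := hlt i j; have := hlt i j'; have := h2 i j'; do 2 case: ifP; lia.
rewrite !glueE //= => hn; have := h4 _ _ j h; have := h1 i j; have := hlt i j.
have := hlt i' j; have := hs2 _ _ h; rewrite /parts.
by move: hn; do 2 case: ifP; lia.
Qed.

Lemma shape_below_glue k f g F : k < n -> box_tableau k g F ->
  shape_below k (glue f k F) = g.
Proof.
move=> hk /box_tableauP[h1 h2 _ _]; apply/ffunP => i; apply/val_inj.
rewrite -[LHS]/(parts (shape_below k (glue f k F)) i) shape_below_card.
rewrite -[RHS](@card_ord_ltn d); last exact: ltn_ord (g i).
apply: eq_card => j; rewrite !inE glueE //=.
by case: (ltnP j (g i)) => [/h1|/h2]; case: ifP; lia.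
Qed.

Lemma cut_box_tableau k f F : k < n -> box_tableau k.+1 f F ->
  box_tableau k (shape_below k F) (cut k F).
Proof.
move=> hk hF; have hs := shape_belowP k _ _ hF; rewrite /parts in hs.
case/box_tableauP: hF => h1 h2 h3 h4.
apply/box_tableauP; split=> [i j|i j|i j j' h|i i' j h].
- by rewrite hs cutE; case: ifP; lia.
- rewrite leqNgt hs cutE; case: ifP => // hne h.
  by case: (ltnP j (f i)) => [/h1|/h2]; lia.
- rewrite !cutE; have := h3 i _ _ h; have := ltn_ord (F (i, j)).
  by case: (ltnP j' (f i)) => [/h1|/h2]; do 2 case: ifP; lia.
rewrite !cutE; have := h4 _ _ j h.
by case: (ltnP j (f i')) => [/h1|/h2]; do 2 case: ifP; lia.
Qed.

Lemma cutK k f F : k < n -> box_tableau k.+1 f F -> glue f k (cut k F) = F.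
Proof.
move=> hk /box_tableauP[h1 h2 _ _]; apply/ffunP => [[i j]]; apply/val_inj => /=.
rewrite glueE // cutE /=.
by case: (ltnP j (f i)) => [/h1|/h2]; do 2 case: ifP; lia.
Qed.

Lemma content_glue k f F v : v < k -> k < n -> content (glue f k F) v = content F v.
Proof.
by move=> hv hk; apply: eq_bigr => c _; rewrite glueE //; case: ifP => //; lia.
Qed.

Definition box_tableaux k f (r : nat -> nat) : {set filling} :=
  [set F | box_tableau k f F & [forall v : 'I_k, content F v == r v]].

(** Removing the largest entry peels off a horizontal strip, so sorting tableaux by the remaining
    shape reproduces the recursion of [kostka]. *)
Lemma card_box_tableaux k f r : k <= n -> #|box_tableaux k f r| = kostka k f r.
Proof.
elim: k f => [|k IH] f hk.
  rewrite /=; case: eqP => [hw|hw].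
    have h0 i : f i = 0 :> nat.
      by apply/eqP; move/eqP: hw; rewrite sum_nat_eq0 => /forallP/(_ i).
    rewrite -[RHS](cards1 ([ffun=> ord_max] : filling)); apply: eq_card => F; rewrite !inE.
    apply/andP/eqP => [[/box_tableauP[_ h _ _] _]|->].
      by apply/ffunP => [[i j]]; apply/val_inj; rewrite ffunE /= h // h0.
    split; last by apply/forallP => [[]].
    by apply/box_tableauP; split=> [i j|i j|i j j'|i i' j]; rewrite ?h0 // !ffunE // ltnn.
  apply/eqP; rewrite cards_eq0; apply/eqP/setP => F; rewrite !inE; apply/negP.
  case/andP => /box_tableauP[h _ _ _] _; case: hw.
  rewrite /weight big1 // => i _; apply/eqP; rewrite -leqn0 leqNgt; apply/negP => hi.
  have hd : 0 < d by apply: leq_trans hi _; rewrite -ltnS /parts ltn_ord.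
  by have := h i (Ordinal hd) hi.
rewrite -sum1_card (partition_big (shape_below k) xpredT) //=.
rewrite [RHS]big_mkcond /=; apply: eq_bigr => g _; case: ifP => [/andP[hgf /eqP hw]|hg].
  (* The fibre over an admissible g is the injective image under [glue] of the tableaux of shape
     g. *)
  rewrite -IH ?(ltnW hk) // sum1_card -(@card_in_imset _ _ (glue f k) (box_tableaux k g r)).
    apply: eq_card => F; rewrite unfold_in inE.
    apply/andP/imsetP => [[/andP[hF /forallP hc] /eqP e]|].
      exists (cut k F); last by rewrite (cutK hk hF).
      rewrite inE -e (cut_box_tableau hk hF); apply/forallP => v.
      rewrite -(content_glue f (cut k F) (ltn_ord v) hk) (cutK hk hF).
      exact: hc (widen_ord (leqnSn k) v).
    case=> F'; rewrite inE => /andP[hF' /forallP hc] ->.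
    have hF := glue_box_tableau hk hgf hF'; rewrite hF (shape_below_glue f hk hF') eqxx.
    split=> //; apply/forallP => v; have := ltn_ord v; rewrite ltnS leq_eqVlt.
    case/orP => [/eqP ->|hv]; last by rewrite content_glue //; exact: hc (Ordinal hv).
    have := weight_shape_below hk hF; rewrite (shape_below_glue f hk hF') hw.
    by move/addnI ->.
  move=> F F'; rewrite !inE => /andP[/box_tableauP[h1 h2 _ _] _].
  case/andP => /box_tableauP[h1' h2' _ _] _ /ffunP e; apply/ffunP => [[i j]].
  have := congr1 val (e (i, j)); rewrite /= !glueE // => ev; apply/val_inj => /=.
  case: (ltnP j (g i)) => h; last by rewrite h2 ?h2'.
  by move: ev; have := h1 _ _ h; have := h1' _ _ h; do 2 case: ifP; lia.
rewrite big1 // => F /andP[]; rewrite inE => /andP[hF /forallP/(_ ord_max)/eqP hc] /eqP e.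
by rewrite -e (hstrip_shape_below hk hF) (weight_shape_below hk hF) hc eqxx in hg.
Qed.

End BoxTableaux.

(** * Monomial coefficients of Schur polynomials *)

Section SchurCoefficients.
Variables n d : nat.
Local Notation vec := {ffun 'I_n -> 'I_d.+1}.
Local Notation filling := {ffun 'I_n * 'I_d -> 'I_n.+1}.

(** The zeros of a decreasing sequence come last, so filtering moves no other entry. *)
Lemma nth_filter_pos (s : seq nat) i : sorted geq s ->
  nth 0 [seq x <- s | (0 < x)%N] i = nth 0 s i.
Proof.
elim: s i => [//|x s IH] i /= hs; have hs' := path_sorted hs.
case: posnP => [x0|_]; last by case: i => //= i; rewrite IH.
have h0 y : y \in s -> y = 0%N.
  rewrite path_sortedE in hs; last by move=> a b c; rewrite /geq /=; lia.
  by case/andP: hs => /allP h _ /h; rewrite x0 /geq /= leqn0 => /eqP.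
rewrite (_ : filter _ _ = [::]); last first.
  by apply/eqP; rewrite -size_eq0 size_filter -leqn0 leqNgt -has_count;
     apply/hasP => [[y /h0 ->]].
case: i => [|i] //=; case: (ltnP i (size s)) => hi.
  by rewrite (h0 _ (mem_nth _ hi)).
by rewrite nth_default.
Qed.

Section Fixed.
Variable f : vec.
Hypothesis hf : nonincr f.
Local Notation la := (part_of f).

Lemma nth_part_of i : nth 0%N la i = extend0 (parts f) i.
Proof.
have E m (hm : (m < n)%N) : nth 0%N [seq val (f i) | i <- enum 'I_n] m = f (Ordinal hm).
  rewrite (nth_map (Ordinal hm)) ?size_enum_ord //.
  by congr (parts f _); apply: val_inj; rewrite /= nth_enum_ord.
rewrite /part_of nth_filter_pos.
  case: (ltnP i n) => hi; last by rewrite extend0_out // nth_default // size_map size_enum_ord.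
  by rewrite E -[i in RHS]/(val (Ordinal hi)) extend0E.
apply/(sortedP 0%N) => k; rewrite size_map size_enum_ord => hk.
by rewrite (E _ hk) (E _ (ltnW hk)); have /nonincrP := hf; apply => /=.
Qed.

Lemma part_of_gt0 i : (i < size la)%N -> (0 < nth 0%N la i)%N.
Proof. by move=> hi; have := mem_nth 0%N hi; rewrite mem_filter => /andP[]. Qed.

Lemma size_part_of : (size la <= n)%N.
Proof. by rewrite size_filter (leq_trans (count_size _ _)) // size_map size_enum_ord. Qed.

Lemma head_part_of : (head 0%N la <= d)%N.
Proof.
rewrite -nth0 nth_part_of; apply: (@extend0_ind n (fun _ x => x <= d)%N) => // i.
by rewrite -ltnS ltn_ord.
Qed.

Definition cell_box (a : cell la) : 'I_n * 'I_d :=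
  (widen_ord size_part_of (val a).1, widen_ord head_part_of (val a).2).

Lemma cell_box_inj : injective cell_box.
Proof.
move=> a b [] e1 e2; apply/val_inj; case: a b e1 e2 => [[a1 a2] ha] [[b1 b2] hb] /= e1 e2.
by congr (_, _); apply/val_inj.
Qed.

Lemma cell_box_in a : ((cell_box a).2 < f (cell_box a).1)%N.
Proof.
have := valP a; rewrite /= nth_part_of.
by rewrite -[nat_of_ord (val a).1]/(val (cell_box a).1) extend0E.
Qed.

Lemma cell_boxP c : reflect (exists a, cell_box a = c) (c.2 < f c.1)%N.
Proof.
apply: (iffP idP) => [|[a <-]]; last exact: cell_box_in.
case: c => i j /= hij.
have hn : nth 0%N la i = f i by rewrite nth_part_of extend0E.
have hi : (i < size la)%N.
  by rewrite ltnNge; apply/negP => h; move: hn; rewrite nth_default //; lia.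
have hj : (j < head 0%N la)%N.
  apply: leq_trans hij _; rewrite -nth0 -hn !nth_part_of extend0E.
  have n0 : (0 < n)%N by apply: leq_ltn_trans (ltn_ord i).
  by rewrite -[0%N]/(val (Ordinal n0)) extend0E; apply: (nonincrP _ hf).
have hc : ((Ordinal hi, Ordinal hj).2 < nth 0 la (Ordinal hi, Ordinal hj).1)%N.
  by rewrite /= hn.
by exists (exist (fun p : 'I_(size la) * 'I_(head 0%N la) => (p.2 < nth 0 la p.1)%N)
  (Ordinal hi, Ordinal hj) hc); rewrite /cell_box /=; congr (_, _); apply/val_inj.
Qed.

Lemma cell_box_val a i j : cell_box a = (i, j) ->
  (val a).1 = i :> nat /\ (val a).2 = j :> nat.
Proof. by case=> <- <-. Qed.

Definition fill_box (T : {ffun cell la -> 'I_n}) : filling :=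
  [ffun c => if [pick a | cell_box a == c] is Some a
             then widen_ord (leqnSn n) (T a) else ord_max].

Lemma fill_box_in T a : fill_box T (cell_box a) = T a :> nat.
Proof.
rewrite ffunE; case: pickP => [b /eqP/cell_box_inj -> //|/(_ a)].
by rewrite eqxx.
Qed.

Lemma fill_box_out T (i : 'I_n) (j : 'I_d) : (f i <= j)%N -> fill_box T (i, j) = n :> nat.
Proof.
move=> h; rewrite ffunE; case: pickP => [a /eqP e|//].
by have := cell_box_in a; rewrite e /= ltnNge h.
Qed.

Lemma fill_box_inj : injective fill_box.
Proof.
move=> T T' e; apply/ffunP => a; apply/val_inj.
by rewrite /= -!fill_box_in e.
Qed.

Lemma fill_box_tableau T : box_tableau n f (fill_box T) = is_ssyt T.
Proof.
apply/box_tableauP/forallP => [[_ _ h3 h4] a|h].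
  apply/forallP => b; apply/andP; split; apply/implyP => /andP[/eqP e h].
    rewrite -!fill_box_in.
    have := h3 (cell_box a).1 (cell_box a).2 (cell_box b).2 h.
    by rewrite -surjective_pairing {2}/cell_box /= e.
  rewrite -!fill_box_in.
  have := h4 (cell_box a).1 (cell_box b).1 (cell_box a).2 h.
  rewrite -surjective_pairing.
  rewrite (_ : ((cell_box b).1, (cell_box a).2) = cell_box b); last by rewrite /cell_box /= e.
  by apply; rewrite fill_box_in.
have {}h a b : _ /\ _ := andP (forallP (h a) b).
split=> [i j|i j|i j j' hj|i i' j hi].
- by move=> /(cell_boxP (i, j))[a <-]; rewrite fill_box_in.
- exact: fill_box_out.
- case: (ltnP j' (f i)) => [h1|h1]; last by rewrite (fill_box_out _ h1) -ltnS.
  have /(cell_boxP (i, j))[a ea] : (j < f i)%N by apply: ltn_trans h1.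
  have /(cell_boxP (i, j'))[b eb] := h1.
  rewrite -ea -eb !fill_box_in; apply: (implyP (h a b).1).
  case: (cell_box_val ea) (cell_box_val eb) => e1 e2 [e3 e4].
  by rewrite -val_eqE /= e1 e2 e3 e4 eqxx.
case: (ltnP j (f i')) => [h1|h1]; last by rewrite (fill_box_out _ h1) ltnn.
have /(cell_boxP (i, j))[a ea] : (j < f i)%N.
  by apply: leq_trans h1 _; apply: (nonincrP _ hf); apply: ltnW.
have /(cell_boxP (i', j))[b eb] := h1.
rewrite -ea -eb !fill_box_in => _; apply: (implyP (h a b).2).
case: (cell_box_val ea) (cell_box_val eb) => e1 e2 [e3 e4].
by rewrite -val_eqE /= e1 e2 e3 e4 eqxx.
Qed.

Lemma content_fill_box T v : (v < n)%N ->
  content (fill_box T) v = (\sum_a (T a == v :> nat))%N.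
Proof.
move=> hv; rewrite /content.
transitivity (\sum_(c in cell_box @: [set: cell la])
   (fill_box T c == v :> nat))%N.
  rewrite [RHS]big_mkcond /=; apply: eq_bigr => [[i j]] _; case: imsetP => // h.
  rewrite fill_box_out; last first.
    rewrite leqNgt; apply/negP => /(cell_boxP (i, j))[a e].
    by case: h; exists a; rewrite ?inE ?e.
  by apply/eqP; rewrite eqb0; apply/eqP; lia.
rewrite big_imset /=; last by move=> a b _ _; apply: cell_box_inj.
by apply: eq_big => [a|a _]; rewrite ?inE // fill_box_in.
Qed.

(** The monomial of a tableau is its content, and [fill_box] carries tableaux to box tableaux of the
    same content. *)
Lemma mcoeff_schur m : (schur n la)@_m = kostka n f (extend0 m) :> int.
Proof.
rewrite -card_box_tableaux // /schur raddf_sum /=.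
under eq_bigr => T _ do
  rewrite -(big_morph (fun m => 'X_[m] : {mpoly int[n]}) (@mpolyXD _ _) (@mpolyX0 _ _)) mcoeffX.
rewrite -natr_sum -big_mkcondr sum1_card natz; congr Posz.
rewrite -(card_imset _ fill_box_inj); apply: eq_card => F; rewrite inE.
apply/imsetP/andP => [[T]|[hF /forallP hc]].
  rewrite unfold_in => /andP[hT /eqP hm] ->; rewrite fill_box_tableau; split=> //.
  apply/forallP => v; rewrite content_fill_box // extend0E -hm mnm_sumE.
  by apply/eqP/eq_bigr => a _; rewrite mnm1E.
have /box_tableauP[h1 h2 _ _] := hF.
have ha a : (F (cell_box a) < n)%N.
  by have := h1 _ _ (cell_box_in a); rewrite -surjective_pairing.
pose T : {ffun cell la -> 'I_n} := [ffun a => Ordinal (ha a)].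
have eT : fill_box T = F.
  apply/ffunP => [[i j]]; apply/val_inj => /=.
  case: (ltnP j (f i)) => [/(cell_boxP (i, j))[a <-]|h]; last by rewrite fill_box_out ?h2.
  by rewrite fill_box_in ffunE.
exists T; last by [].
rewrite unfold_in -fill_box_tableau eT hF /=; apply/eqP/mnmP => v.
have := hc v; rewrite -eT content_fill_box // extend0E => /eqP <-.
by rewrite mnm_sumE; apply: eq_bigr => a _; rewrite mnm1E.
Qed.

End Fixed.
End SchurCoefficients.

(** * The bialternant formula for Schur polynomials *)

Section Bialternant.
Variable n : nat.
Local Notation R := {mpoly int[n]}.
Local Notation vec d := {ffun 'I_n -> 'I_d.+1}.

Lemma eq_part_of d d' (f : vec d) (f' : vec d') :
  parts f =1 parts f' -> part_of f = part_of f'.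
Proof. by move=> h; congr filter; apply: eq_map. Qed.

Lemma mcoeffXM (p : R) (k m : 'X_{1..n}) :
  ('X_[k] * p)@_m = if (k <= m)%MM then p@_(m - k) else 0.
Proof.
rewrite mulrC; case: ifP => [h|/negP h]; first by rewrite -{1}(submK h) addmC mcoeffMX.
apply/eqP; rewrite mcoeff_eq0 (perm_mem (msuppMX _ _)); apply/negP => /mapP[k' _ e].
by case: h; rewrite e lem_addr.
Qed.

(** Both sides are signed sums of Kostka numbers of shape f and content m minus a permuted
    staircase. On the right this comes from swapping m with f + delta and factoring the alternant of
    m. *)
Lemma mcoeff_bialternant d (f : vec d) m : nonincr f -> (n <= d)%N -> (mdeg m <= d)%N ->
  (alternant (@delta n) * schur n (part_of f))@_m = (alternant (shifted (parts f)))@_m.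
Proof.
move=> hf hn hm.
have em : m = [multinom m i | i < n] by apply/mnmP => i; rewrite mnmE.
have hmi i : (m i < d.+1)%N.
  by rewrite ltnS; apply: leq_trans hm; rewrite mdegE (bigD1 i) //= leq_addr.
rewrite [in RHS]em mcoeff_alternant_sym (alternant_hsym (leqW hn) hmi).
rewrite {1}alternantE /determinant !mulr_suml !raddf_sum /=.
rewrite [RHS](reindex_inj invg_inj) /=; apply: eq_bigr => s _.
rewrite odd_permV -!mulrA !mcoeff_signM; congr (_ * _); rewrite mcoeffXM.
set k := [multinom _ | i < n]; have hk i : k i = delta ((s^-1)%g i) by rewrite mnmE.
case: ifP => [/mnm_lepP h|/negP h].
  rewrite mcoeff_schur // -kostka_mcoeff //.
    congr (_@__); congr (_ * _); apply: eq_bigr => i _.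
    by rewrite mxE /hsymB -hk h extend0E mnmBE.
  apply: leq_trans hm; rewrite mdegE; apply: leq_sum => i _.
  by rewrite extend0E mnmBE leq_subr.
(* If the permuted staircase does not fit under m, the left term is zero and the right one has a
   zero factor [hsymB]. *)
have [i hi] : exists i, ~~ (k i <= m i)%N.
  by apply/existsP; rewrite -negb_forall; apply/negP => /forallP h'; case: h; apply/mnm_lepP.
by rewrite (bigD1 i) //= mxE /hsymB -hk (negbTE hi) !mul0r mcoeff0.
Qed.

Lemma bialternant d (f : vec d) : nonincr f ->
  alternant (@delta n) * schur n (part_of f) = alternant (shifted (parts f)).
Proof.
(* For each monomial, f is recast with a bound large enough for the degree conditions. *)
move=> hf; apply/mpolyP => m; pose d' := (d + n + mdeg m)%N.
have e : parts (recast d' f) =1 parts f.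
  move=> i; rewrite /parts ffunE inordK // /parts.
  by apply: leq_trans (ltn_ord (f i)) _; rewrite /d'; lia.
have hf' : nonincr (recast d' f).
  by apply/nonincrP => i j hij; rewrite !e; apply: (nonincrP _ hf).
have hn : (n <= d')%N by rewrite /d'; lia.
have hm : (mdeg m <= d')%N by rewrite /d'; lia.
rewrite -(eq_part_of e) (mcoeff_bialternant hf' hn hm).
by congr (_@__); apply: eq_alternant => i; rewrite /shifted e.
Qed.

End Bialternant.

(** * Rectangular partitions as bounded vectors *)

Section Vectors.
Variables n d : nat.
Local Notation vec := {ffun 'I_n -> 'I_d.+1}.

Definition vec_of (s : seq nat) : vec := [ffun i : 'I_n => inord (nth 0%N s i)].

Lemma parts_vec_of s i : (forall j, (nth 0%N s j <= d)%N) ->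
  parts (vec_of s) i = nth 0%N s i.
Proof. by move=> h; rewrite /parts ffunE inordK // ltnS. Qed.

Lemma part_ofK (f : vec) : nonincr f -> vec_of (part_of f) = f.
Proof.
move=> hf; apply/ffunP => i; apply/val_inj.
rewrite ffunE nth_part_of // extend0E /= inordK //; exact: ltn_ord (f i).
Qed.

Lemma eq_pos_seq (s t : seq nat) : (forall i, (i < size s)%N -> (0 < nth 0%N s i)%N) ->
  (forall i, (i < size t)%N -> (0 < nth 0%N t i)%N) -> nth 0%N s =1 nth 0%N t -> s = t.
Proof.
move=> hs ht e; have hst : size s = size t.
  apply/eqP; rewrite eqn_leq; apply/andP; split; rewrite leqNgt; apply/negP => h.
    by have := hs _ h; rewrite e nth_default.
  by have := ht _ h; rewrite -e nth_default.
by apply: (@eq_from_nth _ 0%N).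
Qed.

Lemma nth_rect a l i : nth 0%N (rect a l) i = if (i < l)%N then a else 0%N.
Proof.
rewrite /rect; case: eqP => [->|_]; first by rewrite nth_nil if_same.
by rewrite nth_nseq.
Qed.

(** The case l = 0 serves the empty rectangle, met when M = N and the bound d is zero. *)
Lemma rect_le a l : (l = 0 \/ a <= d)%N -> forall j, (nth 0%N (rect a l) j <= d)%N.
Proof. by move=> h j; rewrite nth_rect; case: ifP => //; case: h => // ->. Qed.

Lemma vec_of_rect_nonincr a l : (l = 0 \/ a <= d)%N -> nonincr (vec_of (rect a l)).
Proof.
move=> h; apply/nonincrP => i j hij; rewrite !parts_vec_of ?nth_rect; try exact: rect_le.
by case: ltnP => // hj; rewrite ifT //; apply: leq_ltn_trans hj.
Qed.

Lemma part_of_rect a l : (l <= n)%N -> (l = 0 \/ a <= d)%N ->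
  part_of (vec_of (rect a l)) = rect a l.
Proof.
move=> hl h; apply: eq_pos_seq => [i|i|i]; first exact: part_of_gt0.
  rewrite nth_rect /rect; case: eqP => // a0; rewrite size_nseq => ->; lia.
rewrite nth_part_of ?vec_of_rect_nonincr //; case: (ltnP i n) => hi.
  rewrite -[i in LHS]/(val (Ordinal hi)) extend0E parts_vec_of //; exact: rect_le.
by rewrite extend0_out // nth_rect ltnNge (leq_trans hl hi).
Qed.

End Vectors.

(** * Block-diagonal determinants and Jacobi-Trudi for rectangles *)

Fixpoint same_block (L : seq nat) (p q : nat) : bool :=
  if L is l :: L' then
    if (p < l)%N then (q < l)%N else (l <= q)%N && same_block L' (p - l) (q - l)
  else true.

Lemma same_blockC L p q : same_block L p q = same_block L q p.
Proof.
elim: L p q => [//|l L IH] p q /=; rewrite IH.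
by case: (ltnP p l); case: (ltnP q l).
Qed.

(** Translation invariance lets each block be indexed from its own origin. *)
Lemma prod_det_blocks (R : comNzRingType) (E : nat -> nat -> R) (L : seq nat) :
  (forall c p q, E (c + p)%N (c + q)%N = E p q) ->
  \prod_(l <- L) \det (\matrix_(p < l, q < l) E p q) =
  \det (\matrix_(p < sumn L, q < sumn L) if same_block L p q then E p q else 0).
Proof.
move=> hE; elim: L => [|l L IH]; first by rewrite big_nil det_mx00.
rewrite big_cons IH -(det_ublock _ 0); congr (\det _).
apply/matrixP => p q; rewrite !mxE; case: splitP => p' ep; rewrite mxE;
  case: splitP => q' eq; rewrite !mxE /= ep eq.
- by rewrite !ltn_ord.
- by rewrite ltn_ord ltnNge leq_addr.
- by rewrite ltnNge leq_addr /= leqNgt ltn_ord.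
by rewrite ltnNge !leq_addr /= !addKn hE.
Qed.

Section RectangularSchur.
Variable n : nat.
Local Notation R := {mpoly int[n]}.

Lemma hsym_indep D D' t : (t < D)%N -> (t < D')%N -> hsym n D t = hsym n D' t.
Proof.
move=> h h'; apply: (@coef_eq_below_prod _ (minn D D')); last by rewrite ltn_min h.
by move=> j _ i; rewrite ltn_min !coef_poly => /andP[-> ->].
Qed.

Lemma schur_rect D b l : (l <= n)%N -> (b + n <= D)%N ->
  schur n (rect b l) = \det (\matrix_(p < l, q < l) hsymB n D (b + q) p).
Proof.
move=> hl hD; have hb : (l = 0 \/ b <= b)%N by right.
rewrite -(part_of_rect hl hb); apply: (mulfI (alternant_delta_neq0 n)).
rewrite bialternant ?vec_of_rect_nonincr // mulrC (alternant_hsym (D := D)); last 2 first.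
- by lia.
- move=> i; rewrite /shifted parts_vec_of ?nth_rect; last exact: rect_le.
  by rewrite /delta; have := ltn_ord i; case: ifP; lia.
congr (_ * _).
pose A m m' : 'M[R]_(m, m') := \matrix_(p, q)
  hsymB n D ((if (p < l)%N then b else 0%N) + q) p.
transitivity (\det (A n n)).
  congr (\det _); apply/matrixP => p q; rewrite !mxE /shifted.
  rewrite parts_vec_of ?nth_rect; last exact: rect_le.
  rewrite /hsymB /delta; have := ltn_ord p; have := ltn_ord q => hq hp.
  set x := (if (p < l)%N then b else 0%N).
  rewrite (_ : (n - q.+1 <= _) = (p <= x + q))%N; last by lia.
  by case: ifP => // h; congr hsym; lia.
have -> : \det (A n n) = \det (A (l + (n - l))%N (l + (n - l))%N) by rewrite subnKC.
set k := (n - l)%N.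
(* Rows from l on belong to zero parts and have entries h_{q-p}, so the matrix is block triangular
   with a unitriangular lower block. *)
have -> : A (l + k)%N (l + k)%N = block_mx (A l l) (ursubmx (A (l + k)%N (l + k)%N)) 0
    (\matrix_(p < k, q < k) hsymB n D q p).
  rewrite -[LHS]submxK; congr block_mx; apply/matrixP => p q; rewrite !mxE //=.
    by rewrite ltnNge leq_addr /= /hsymB ifF //; have := ltn_ord q; lia.
  rewrite ltnNge leq_addr /= add0n /hsymB leq_add2l; case: ifP => // _.
  by rewrite subnDl.
rewrite det_ublock [X in _ * X](_ : _ = 1) ?mulr1.
  by congr (\det _); apply/matrixP => p q; rewrite !mxE ltn_ord.
rewrite -det_tr det_trig; last first.
  by apply/is_trig_mxP => p q hpq; rewrite !mxE /hsymB leqNgt hpq.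
rewrite big1 // => p _; rewrite !mxE /hsymB leqnn subnn hsym0 //.
by have := ltn_ord p; rewrite /k; lia.
Qed.

End RectangularSchur.

(** * Littlewood-Richardson coefficients of rectangles and their duality *)

Section RectangularLR.
Variables (n : nat) (L : seq nat).
Local Notation M := (sumn L).
Local Notation R := {mpoly int[n]}.
Local Notation vec d := {ffun 'I_n -> 'I_d.+1}.

(** Selects the terms of the block determinant not zero by construction; the inequality makes the
    truncated subtraction in [jt_exponents] exact. *)
Definition jt_perm b (w : 'S_M) :=
  [forall p : 'I_M, same_block L p (w p) && (p <= b + w p)%N].

Definition jt_exponents b (w : 'S_M) : nat -> nat :=
  extend0 (fun p : 'I_M => b + w p - p)%N.

Lemma jt_exponentsE b w (p : 'I_M) : jt_exponents b w p = (b + w p - p)%N.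
Proof. exact: extend0E. Qed.

Definition rect_lr b d (f : vec d) : int :=
  \sum_(w : 'S_M | jt_perm b w) (-1) ^+ w * (kostka M f (jt_exponents b w))%:Z.

Lemma sum_jt_exponents b w : jt_perm b w ->
  (\sum_(p < M) jt_exponents b w p = b * M)%N.
Proof.
move=> /forallP h.
have : (\sum_(p < M) jt_exponents b w p + \sum_(p < M) p =
        \sum_(p < M) b + \sum_(p < M) p)%N.
  rewrite [X in (_ = _ + X)%N](reindex_inj (@perm_inj _ w)) -!big_split /=.
  by apply: eq_bigr => p _; rewrite jt_exponentsE; have /andP[_] := h p; lia.
by move/addIn ->; rewrite sum_nat_const card_ord mulnC.
Qed.

Lemma leq_sumn l : l \in L -> (l <= M)%N.
Proof. by rewrite sumnE => hl; rewrite (big_rem l) //= leq_addr. Qed.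

Hypothesis hM : (M <= n)%N.

Lemma prod_schur_rect b :
  \prod_(l <- L) schur n (rect b l) =
  \sum_(w : 'S_M | jt_perm b w)
     (-1) ^+ w * \prod_(p < M) hsym n (b * M).+1 (jt_exponents b w p).
Proof.
(* [b + n] is what [schur_rect] requires, and [b * M] bounds every exponent. *)
pose D := ((b * M + b + n).+1)%N.
pose E p q : R := hsymB n D (b + q) p.
have -> : \prod_(l <- L) schur n (rect b l) =
    \prod_(l <- L) \det (\matrix_(p < l, q < l) E p q).
  rewrite big_seq [RHS]big_seq; apply: eq_bigr => l /leq_sumn hl.
  by apply: schur_rect; [apply: leq_trans hM | rewrite /D; lia].
rewrite prod_det_blocks; last first.
  by move=> c p q; rewrite /E /hsymB addnCA leq_add2l subnDl.
rewrite /determinant [RHS]big_mkcond /=; apply: eq_bigr => w _.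
case: ifP => [hw|/negbT]; last first.
  rewrite negb_forall => /existsP[p hp]; rewrite (bigD1 p) //= mxE /E /hsymB.
  by case: same_block hp => [/negbTE|_]; rewrite /= ?mul0r ?mulr0 // => ->; rewrite mul0r mulr0.
congr (_ * _); apply: eq_bigr => p _; rewrite mxE /E /hsymB.
have hle : (jt_exponents b w p <= b * M)%N.
  by rewrite -(sum_jt_exponents hw) (bigD1 p) //= leq_addr.
move/forallP/(_ p)/andP: hw => [-> hp]; rewrite hp.
move: hle; rewrite jt_exponentsE => hle; apply: hsym_indep; rewrite ltnS //.
by apply: leq_trans hle _; rewrite -addnA leq_addr.
Qed.

Lemma rect_lr_alternant b :
  alternant (@delta n) * \prod_(l <- L) schur n (rect b l) =
  \sum_(f : vec (b * M) | nonincr f) (rect_lr b f)%:~R * alternant (shifted (parts f)).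
Proof.
rewrite prod_schur_rect mulr_sumr.
under [RHS]eq_bigr => f _ do rewrite /rect_lr rmorph_sum mulr_suml.
rewrite [RHS]exchange_big /=; apply: eq_bigr => w hw.
rewrite mulrCA [alternant _ * _]mulrC kostka_prod_nonincr ?sum_jt_exponents //.
rewrite mulr_sumr; apply: eq_bigr => f _.
by rewrite rmorphM rmorph_sign mulrA.
Qed.

Lemma sumn_rects b : sumn (map sumn [seq rect b l | l <- L]) = (b * M)%N.
Proof.
elim: L => [|l L' IH] /=; first by rewrite muln0.
rewrite IH mulnDr; congr (_ + _)%N; rewrite /rect; case: eqP => [->|_] //.
by rewrite sumn_nseq.
Qed.

Lemma rect_lr_exists b :
  is_LR_expansion n [seq rect b l | l <- L] (fun s => rect_lr b (vec_of n (b * M) s)).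
Proof.
rewrite /is_LR_expansion sumn_rects big_map.
apply: (mulfI (alternant_delta_neq0 n)); rewrite rect_lr_alternant mulr_sumr.
by apply: eq_bigr => f hf; rewrite part_ofK // mulrCA bialternant.
Qed.

(** After multiplication by the Vandermonde alternant, both expansions are read at the monomial f +
    delta. *)
Lemma rect_lr_unique b c (f : vec (b * M)) : nonincr f ->
  is_LR_expansion n [seq rect b l | l <- L] c -> c (part_of f) = rect_lr b f.
Proof.
move=> hf; rewrite /is_LR_expansion sumn_rects big_map.
move/(congr1 (fun p => (alternant (@delta n) * p)@_[multinom shifted (parts f) i | i < n])).
rewrite rect_lr_alternant mcoeff_alternant_sum // => ->.
rewrite -(mcoeff_alternant_sum (fun g => c (part_of g)) hf) mulr_sumr.
by congr (_@__); apply: eq_bigr => g hg; rewrite mulrCA bialternant.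
Qed.

(** With p = w^-1 q, the bound b + q - p <= b + b' says q <= b' + p. *)
Lemma jt_perm_bound b b' w : (b + b' = M)%N -> jt_perm b w ->
  (forall p, (jt_exponents b w p <= M)%N) -> jt_perm b' w^-1.
Proof.
move=> hb /forallP hw hM'; apply/forallP => q.
have := hw ((w^-1)%g q); have := hM' ((w^-1)%g q); rewrite jt_exponentsE permKV same_blockC.
by move=> h /andP[-> _] /=; lia.
Qed.

Lemma parts_vec_of_rect d a l (i : 'I_n) : (l = 0 \/ a <= d)%N ->
  parts (vec_of n d (rect a l)) i = if (i < l)%N then a else 0%N.
Proof. by move=> h; rewrite parts_vec_of ?nth_rect //; apply: rect_le. Qed.

Lemma kostka_rect_bound d b w : (b = 0 \/ M <= d)%N ->
  kostka M (vec_of n d (rect M b)) (jt_exponents b w) != 0%N ->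
  forall p, (jt_exponents b w p <= M)%N.
Proof.
move=> hd hk p; case: (ltnP p M) => hp; last by rewrite /jt_exponents extend0_out.
apply: (kostka_size_le _ hk) => // i; rewrite parts_vec_of_rect //.
by case: ifP.
Qed.

(* The complement of the rectangle turns the exponents r into M - r, and these
   are the exponents of the inverse permutation, permuted by w. *)
Lemma kostka_rect_dual d d' b b' w : (b + b' = M)%N -> (b = 0 \/ M <= d)%N ->
  (b' = 0 \/ M <= d')%N -> (b' * M <= d')%N -> jt_perm b w -> jt_perm b' w^-1 ->
  kostka M (vec_of n d (rect M b)) (jt_exponents b w) =
  kostka M (vec_of n d' (rect M b')) (jt_exponents b' w^-1).
Proof.
move=> hb hd hd' hbd hw hw'.
have hr l : (l = 0 \/ M <= M)%N by right.
have hle (p : 'I_M) : (jt_exponents b w p <= M)%N.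
  by have /forallP/(_ (w p))/andP[_] := hw'; rewrite permK jt_exponentsE; lia.
rewrite (@kostka_recast n d M _ _ (vec_of n M (rect M b))); last first.
  by move=> i; rewrite !parts_vec_of_rect.
(* The complement is taken in the M x M square, one row per strip, where (M^b) becomes (M^b'). *)
rewrite (@kostka_flip n M M M M _ (vec_of n M (rect M b'))) //.
- rewrite (@kostka_recast n M d' _ _ (vec_of n d' (rect M b'))); last first.
    by move=> i; rewrite !parts_vec_of_rect.
  apply: (kostka_perm (s := w)); first exact: vec_of_rect_nonincr.
    by rewrite sum_jt_exponents.
  move=> p; have := hle p; rewrite !jt_exponentsE permK.
  have /forallP/(_ p)/andP[_] := hw; lia.
- split=> i; rewrite parts_vec_of_rect //; first by case: ifP.
  by move=> hi; rewrite ifF //; lia.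
- move=> i; rewrite parts_vec_of_rect // /flip; case: (ltnP i M) => hi; last first.
    by rewrite ifF //; lia.
  have hi' : (M.-1 - i < n)%N by lia.
  rewrite -[(M.-1 - i)%N]/(val (Ordinal hi')) extend0E parts_vec_of_rect //=.
  by do 2 case: ifP; lia.
by move=> p hp; apply: hle (Ordinal hp).
Qed.

(** The sums are matched by w -> w^-1. When only one of the two permutations is admissible, its
    Kostka number vanishes, since otherwise [jt_perm_bound] would make the other admissible. *)
Lemma rect_lr_dual d d' b b' : (b + b' = M)%N -> (b = 0 \/ M <= d)%N ->
  (b' = 0 \/ M <= d')%N -> (b' * M <= d')%N ->
  rect_lr b (vec_of n d (rect M b)) = rect_lr b' (vec_of n d' (rect M b')).
Proof.
move=> hb hd hd' hbd; rewrite /rect_lr [RHS](reindex_inj invg_inj) /=.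
rewrite big_mkcond [RHS]big_mkcond /=; apply: eq_bigr => w _.
rewrite odd_permV.
case: (boolP (jt_perm b w)) => hw; case: (boolP (jt_perm b' w^-1)) => hw' //.
- by rewrite (kostka_rect_dual hb hd hd' hbd hw hw').
- have [->|/(kostka_rect_bound hd) h] :=
    eqVneq (kostka M (vec_of n d (rect M b)) (jt_exponents b w)) 0%N.
    by rewrite mulr0.
  by rewrite (jt_perm_bound hb hw h) in hw'.
have [->|/(kostka_rect_bound hd') h] :=
    eqVneq (kostka M (vec_of n d' (rect M b')) (jt_exponents b' w^-1)) 0%N.
  by rewrite mulr0.
have hb2 : (b' + b = M)%N by rewrite addnC.
by have := jt_perm_bound hb2 hw' h; rewrite invgK (negbTE hw).
Qed.

End RectangularLR.

Local Close Scope ring_scope.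

(** The equality concerns arbitrary families satisfying the expansions; the existence claims keep it
    from being vacuous. *)
Theorem theorem6p5 (N : nat) (L : seq nat) :
  (0 < N)%N ->
  sorted geq L ->
  (head 0 L <= N)%N ->
  (N <= sumn L)%N ->
  let M := sumn L in
  forall n : nat, (M <= n)%N ->
    (exists c1, is_LR_expansion n [seq rect N l | l <- L] c1) /\
    (exists c2, is_LR_expansion n [seq rect (M - N) l | l <- L] c2) /\
    (forall c1 c2 : seq nat -> int,
       is_LR_expansion n [seq rect N l | l <- L] c1 ->
       is_LR_expansion n [seq rect (M - N) l | l <- L] c2 ->
       c1 (rect M N) = c2 (rect M (M - N))).
Proof.
move=> N_gt0 _ _ hNM M n hM.
split; first by eexists; apply: rect_lr_exists.
split; first by eexists; apply: rect_lr_exists.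
have hN : (N = 0 \/ M <= N * M)%N by right; rewrite leq_pmull.
have hN' : (M - N = 0 \/ M <= (M - N) * M)%N.
  by case: (posnP (M - N)%N) => h; [left | right; rewrite leq_pmull].
move=> c1 c2 h1 h2.
rewrite -(part_of_rect (leq_trans hNM hM) hN).
rewrite -(part_of_rect (leq_trans (leq_subr N M) hM) hN').
rewrite (rect_lr_unique hM _ h1) ?(rect_lr_unique hM _ h2) ?vec_of_rect_nonincr //.
by apply: rect_lr_dual => //; rewrite subnKC.
Qed.
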